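(* Let $c$ be an hpgcl program and $X\in\mathbb{E}_{\le1}$. Then $\mathrm{wp}[c](X)=1-\mathrm{awlep}[c](1-X)$, $\mathrm{wlp}[c](X)=1-\mathrm{awep}[c](1-X)$, $\mathrm{wep}[c](X)=1-\mathrm{awlp}[c](1-X)$, and $\mathrm{wlep}[c](X)=1-\mathrm{awp}[c](1-X)$.
   Context: Programs of hpgcl: $c::=\mathtt{skip}\mid x:=e\mid c;c\mid\mathtt{if}\,(b)\,\{c\}\,\mathtt{else}\,\{c\}\mid\mathtt{while}\,(b)\,\{c\}\mid\{c\}\,[p]\,\{c\}\mid x:=\mathtt{new}(e_1,\dots,e_n)\mid\langle e\rangle:=e'\mid x:=\langle e\rangle\mid\mathtt{free}(e)$, with $x$ a variable, $e,e',e_i$ arithmetic expressions over variables, $b$ a Boolean guard over variables, $p\in[0,1]\cap\mathbb{Q}$. States are pairs $(s,h)$ of a stack $s:\mathrm{Vars}\to\mathbb{Z}$ and a heap $h:N\to\mathbb{Z}$, $N=\mathrm{dom}(h)\subseteq\mathbb{N}_{>0}$ finite; $\Sigma$ is the set of states; $s(e)$ is the value of $e$; heaps are disjoint ($\perp$) if their domains are and $h_1\star h_2$ is their union. $\mathbb{E}_{\le1}$ is the set of functions $\Sigma\to[0,1]$ ordered pointwise (a complete lattice); arithmetic, $\sup,\inf$ pointwise, taken in $[0,1]$. $[\varphi]$ is the indicator of predicate $\varphi$. $[e\mapsto e_1,\dots,e_n](s,h)=1$ iff $\mathrm{dom}(h)=\{s(e),\dots,s(e)+n-1\}$ and $h(s(e)+i-1)=s(e_i)$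 for all $i$; $[e\mapsto -](s,h)=1$ iff $\mathrm{dom}(h)=\{s(e)\}$. $X[x/e]=\lambda(s,h).X(s[x\mapsto s(e)],h)$. Connectives: $(X\star Y)(s,h)=\max\{X(s,h_1)Y(s,h_2)\mid h=h_1\star h_2\}$; $([\varphi]\mathbin{-\!\!\star}Y)(s,h)=\inf\{Y(s,h\star h')\mid h'\perp h,(s,h')\models\varphi\}$; $(X\bullet Y)(s,h)=\min\{1-X(s,h_1)+X(s,h_1)Y(s,h_2)\mid h=h_1\star h_2\}$; $([\varphi]\mathbin{-\!\!\bullet}Y)(s,h)=\sup\{Y(s,h\star h')\mid h'\perp h,(s,h')\models\varphi\}$. Eight transformers $T[c]:\mathbb{E}_{\le1}\to\mathbb{E}_{\le1}$ are defined, named by which of the flags A (angelic), L (liberal), E (extrinsic memory safety) they carry: $\mathrm{wp}$ (none), $\mathrm{awp}$ (A), $\mathrm{wlp}$ (L), $\mathrm{wep}$ (E), $\mathrm{awlp}$ (A,L), $\mathrm{awep}$ (A,E), $\mathrm{wlep}$ (L,E), $\mathrm{awlep}$ (A,L,E). Write $\otimes,\multimap$ for $\star,\mathbin{-\!\!\star}$ if E is absent and for $\bullet,\mathbin{-\!\!\bullet}$ if E is present. Rules: $T[\mathtt{skip}](X)=X$; $T[x:=e](X)=X[x/e]$; $T[c_1;c_2](X)=T[c_1](T[c_2](X))$; $T[\mathtt{if}\,(b)\,\{c_1\}\,\mathtt{else}\,\{c_2\}](X)=[b]\cdot T[c_1](X)+[\neg b]\cdot T[c_2](X)$; $T[\{c_1\}[p]\{c_2\}](X)=p\cdot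 T[c_1](X)+(1-p)\cdot T[c_2](X)$; $T[\mathtt{while}\,(b)\,\{c'\}](X)$ is the least fixed point (without L) resp. greatest fixed point (with L) of $Y\mapsto[\neg b]\cdot X+[b]\cdot T[c'](Y)$; $T[x:=\mathtt{new}(e_1,\dots,e_n)](X)(s,h)$ is the infimum (without A) resp. supremum (with A) of $([v\mapsto e_1,\dots,e_n]\multimap X[x/v])(s,h)$ over all $v\in\mathbb{N}_{>0}$ with $v,\dots,v+n-1\notin\mathrm{dom}(h)$; $T[x:=\langle e\rangle](X)=\sup_{v\in\mathbb{Z}}[e\mapsto v]\star([e\mapsto v]\mathbin{-\!\!\star}X[x/v])$ without E, and $\inf_{v\in\mathbb{Z}}[e\mapsto v]\bullet([e\mapsto v]\mathbin{-\!\!\bullet}X[x/v])$ with E; $T[\langle e\rangle:=e'](X)=[e\mapsto -]\otimes([e\mapsto e']\multimap X)$; $T[\mathtt{free}(e)](X)=[e\mapsto -]\otimes X$. *)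

(* Defs.v *)
From HB Require Import structures.
From mathcomp Require Import all_boot all_order all_algebra finmap.
From mathcomp Require Import all_classical all_reals numfun lra.

Set Implicit Arguments.
Unset Strict Implicit.
Unset Printing Implicit Defensive.

Import Order.TTheory GRing.Theory Num.Theory.

Local Open Scope classical_set_scope.
Local Open Scope ring_scope.

(* Addresses are kept in [int] so that they compare directly with values of
   expressions; [hpos] restricts them to positive integers. *)
Record heap := Heap {
  hmap : {fmap int -> int};
  hpos : all (fun a : int => 0 < a) (domf hmap) }.

HB.instance Definition _ := [isSub for hmap].

Definition dom (h : heap) : {fset int} := domf (hmap h).

Definition hdisj (h1 h2 : heap) : bool := fdisjoint (dom h1) (dom h2).

Lemma hunion_subproof (h1 h2 : heap) :
  all (fun a : int => 0 < a) (domf (catf (hmap h1) (hmap h2))).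
Proof.
apply/allP => a; rewrite domf_cat inE => /orP[].
- exact: (allP (hpos h1)).
- exact: (allP (hpos h2)).
Qed.

(* The union of two heaps; only meaningful when they are disjoint. *)
Definition hunion (h1 h2 : heap) : heap := Heap (hunion_subproof h1 h2).

Section Syntax.
Variable Var : eqType.

Definition stack := Var -> int.

Definition state := (stack * heap)%type.

(* Expressions and guards are represented by their value as a function of the
   stack, so that no particular expression syntax is fixed. *)
Definition aexp := stack -> int.
Definition bexp := stack -> bool.

Inductive cmd : Type :=
| Skip
| Assign (x : Var) (e : aexp)
| Seq (c1 c2 : cmd)
| If (b : bexp) (c1 c2 : cmd)
| While (b : bexp) (c : cmd)
| PChoice (c1 : cmd) (p : {p : rat | 0 <= p <= 1}) (c2 : cmd)
| New (x : Var) (es : seq aexp)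
| Mutate (e e' : aexp)
| Lookup (x : Var) (e : aexp)
| Free (e : aexp).

Definition upd (s : stack) (x : Var) (v : int) : stack :=
  fun y => if y == x then v else s y.

Definition pointsto (e : aexp) (es : seq aexp) : set state :=
  [set st | dom st.2 = [fset (e st.1 + i%:Z)%R | i in iota 0 (size es)]%fset /\
    forall i : nat, (i < size es)%N ->
      (hmap st.2).[? (e st.1 + i%:Z)%R]%fmap
        = Some (nth (fun=> 0) es i st.1)].

Definition allocated (e : aexp) : set state :=
  [set st | dom st.2 = [fset e st.1]%fset].

End Syntax.

Arguments Skip {Var}.

Section Transformers.
Variables (R : realType) (Var : eqType).

Local Notation state := (state Var).
Local Notation aexp := (aexp Var).
Local Notation cmd := (cmd Var).

(* The lattice of [0, 1]-valued functions, as a subset of all real-valued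
   functions on states; [trans_mono] shows that it is preserved by all the
   transformers. *)
Definition one_bounded : set (state -> R) :=
  [set X | forall st, 0 <= X st <= 1].

(* Suprema and infima in the complete lattice [0, 1]: adding the bottom (top)
   element makes the supremum (infimum) of the empty set 0 (resp. 1), and
   changes nothing for non-empty subsets of [0, 1]. *)
Definition sup01 (A : set R) : R := sup (0 |` A).
Definition inf01 (A : set R) : R := inf (1 |` A).

Definition subst (X : state -> R) (x : Var) (e : aexp) : state -> R :=
  fun st => X (upd st.1 x (e st.1), st.2).

(* [sepcon] and [sepdis] range over the finitely many splittings of a heap, so
   the supremum and infimum are a maximum and a minimum. *)
Definition sepcon (X Y : state -> R) : state -> R := fun st =>
  sup01 [set r | exists h1 h2, [/\ hdisj h1 h2, st.2 = hunion h1 h2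
    & r = X (st.1, h1) * Y (st.1, h2)]].

Definition sepimp (phi : set state) (Y : state -> R) : state -> R := fun st =>
  inf01 [set r | exists h', [/\ hdisj h' st.2, phi (st.1, h')
    & r = Y (st.1, hunion st.2 h')]].

Definition sepdis (X Y : state -> R) : state -> R := fun st =>
  inf01 [set r | exists h1 h2, [/\ hdisj h1 h2, st.2 = hunion h1 h2
    & r = 1 - X (st.1, h1) + X (st.1, h1) * Y (st.1, h2)]].

Definition sepcoimp (phi : set state) (Y : state -> R) : state -> R := fun st =>
  sup01 [set r | exists h', [/\ hdisj h' st.2, phi (st.1, h')
    & r = Y (st.1, hunion st.2 h')]].

Definition is_lfp (F : (state -> R) -> state -> R) (Y : state -> R) : Prop :=
  [/\ one_bounded Y, F Y = Y &
    forall Z, one_bounded Z -> F Z = Z -> forall st, Y st <= Z st].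

Definition is_gfp (F : (state -> R) -> state -> R) (Y : state -> R) : Prop :=
  [/\ one_bounded Y, F Y = Y &
    forall Z, one_bounded Z -> F Z = Z -> forall st, Z st <= Y st].

(* The default values are never used: see [while_fpP] below. *)
Definition lfp (F : (state -> R) -> state -> R) : state -> R :=
  xget (cst 0) [set Y | is_lfp F Y].
Definition gfp (F : (state -> R) -> state -> R) : state -> R :=
  xget (cst 1) [set Y | is_gfp F Y].

Definition guard (b : bexp Var) : set state := [set st | b st.1].

Definition while_fun (b : bexp Var) (X : state -> R)
    (G : (state -> R) -> state -> R) (Y : state -> R) : state -> R := fun st =>
  \1_(~` guard b) st * X st + \1_(guard b) st * G Y st.

Definition con (extrinsic : bool) := if extrinsic then sepdis else sepcon.
Definition imp (extrinsic : bool) := if extrinsic then sepcoimp else sepimp.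

Section Rules.
Variables angelic liberal extrinsic : bool.

Local Notation otimes := (con extrinsic).
Local Notation lolli := (imp extrinsic).

Fixpoint trans (c : cmd) (X : state -> R) : state -> R :=
  match c with
  | Skip => X
  | Assign x e => subst X x e
  | Seq c1 c2 => trans c1 (trans c2 X)
  | If b c1 c2 => fun st =>
      \1_(guard b) st * trans c1 X st + \1_(~` guard b) st * trans c2 X st
  | While b c' =>
      (if liberal then gfp else lfp) (while_fun b X (trans c'))
  | PChoice c1 p c2 => fun st =>
      ratr (val p) * trans c1 X st + (1 - ratr (val p)) * trans c2 X st
  | New x es => fun st =>
      (if angelic then sup01 else inf01)
        [set lolli (pointsto (cst v) es) (subst X x (cst v)) st | v in
          [set v : int | 0 < v /\
            forall i : nat, (i < size es)%N -> v + i%:Z \notin dom st.2]]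
  | Mutate e e' => otimes \1_(allocated e) (lolli (pointsto e [:: e']) X)
  | Lookup x e => fun st =>
      (if extrinsic then inf01 else sup01)
        [set otimes \1_(pointsto e [:: cst v])
                  (lolli (pointsto e [:: cst v]) (subst X x (cst v))) st
        | v in [set: int]]
  | Free e => otimes \1_(allocated e) X
  end.

End Rules.

Definition wp    := trans false false false.
Definition awp   := trans true  false false.
Definition wlp   := trans false true  false.
Definition wep   := trans false false true.
Definition awlp  := trans true  true  false.
Definition awep  := trans true  false true.
Definition wlep  := trans false true  true.
Definition awlep := trans true  true  true.

(* Well-definedness: every transformer preserves [one_bounded], and the fixed
   points in the rule for loops exist. *)

Lemma sup01_itv (A : set R) :
  (forall r, A r -> 0 <= r <= 1) -> 0 <= sup01 A <= 1.
Proof.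
move=> A01; have ub1 : ubound (0 |` A) 1.
  by move=> r [->|/A01/andP[]//]; exact: ler01.
apply/andP; split; first by apply: ub_le_sup; [exists 1|left].
by apply: ge_sup => //; exists 0; left.
Qed.

Lemma inf01_itv (A : set R) :
  (forall r, A r -> 0 <= r <= 1) -> 0 <= inf01 A <= 1.
Proof.
move=> A01; have lb0 : lbound (1 |` A) 0.
  by move=> r [->|/A01/andP[]//]; exact: ler01.
apply/andP; split; last by apply: ge_inf; [exists 0|left].
by apply: lb_le_inf => //; exists 1; left.
Qed.

Lemma sup01_ub (A : set R) r :
  (forall r, A r -> 0 <= r <= 1) -> A r -> r <= sup01 A.
Proof.
move=> A01 Ar; apply: ub_le_sup; last by right.
by exists 1 => t [->|/A01/andP[]//]; exact: ler01.
Qed.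

Lemma inf01_lb (A : set R) r :
  (forall r, A r -> 0 <= r <= 1) -> A r -> inf01 A <= r.
Proof.
move=> A01 Ar; apply: ge_inf; last by right.
by exists 0 => t [->|/A01/andP[]//]; exact: ler01.
Qed.

Lemma sup01_le (A : set R) r :
  0 <= r -> (forall t, A t -> t <= r) -> sup01 A <= r.
Proof.
by move=> r0 Ar; apply: ge_sup; [exists 0; left|move=> t [->|/Ar]].
Qed.

Lemma inf01_ge (A : set R) r :
  r <= 1 -> (forall t, A t -> r <= t) -> r <= inf01 A.
Proof.
by move=> r1 Ar; apply: lb_le_inf; [exists 1; left|move=> t [->|/Ar]].
Qed.

Lemma sup01_mono (A B : set R) :
    (forall r, B r -> 0 <= r <= 1) ->
    (forall r, A r -> exists2 t, B t & r <= t) ->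
  sup01 A <= sup01 B.
Proof.
move=> B01 AB; have /andP[s0 _] := sup01_itv B01.
apply: sup01_le => // r /AB[t Bt /le_trans]; apply.
exact: sup01_ub.
Qed.

Lemma inf01_mono (A B : set R) :
    (forall r, A r -> 0 <= r <= 1) ->
    (forall r, B r -> exists2 t, A t & t <= r) ->
  inf01 A <= inf01 B.
Proof.
move=> A01 BA; have /andP[_ s1] := inf01_itv A01.
apply: inf01_ge => // r /BA[t At]; apply: le_trans.
exact: inf01_lb.
Qed.

Definition le_fun (X Y : state -> R) := forall st, X st <= Y st.

Definition monotone01 (F : (state -> R) -> state -> R) :=
  (forall X, one_bounded X -> one_bounded (F X)) /\
  (forall X Y, one_bounded X -> one_bounded Y -> le_fun X Y ->
    le_fun (F X) (F Y)).

Lemma lfpP F : monotone01 F -> is_lfp F (lfp F) /\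
  forall Z, one_bounded Z -> le_fun (F Z) Z -> le_fun (lfp F) Z.
Proof.
move=> [FE Fm].
pose P := [set Y | one_bounded Y /\ le_fun (F Y) Y].
pose M st := inf01 [set Y st | Y in P].
have P01 st r : [set Y st | Y in P] r -> 0 <= r <= 1.
  by move=> [Y [YE _] <-]; exact: YE.
have ME : one_bounded M by move=> st; apply: inf01_itv; exact: P01.
have MP Y : P Y -> le_fun M Y.
  by move=> PY st; apply: inf01_lb; [exact: P01|exists Y].
have FM : le_fun (F M) M.
  move=> st; apply: inf01_ge; first by case/andP: (FE _ ME st).
  move=> _ [Y PY <-]; have [YE FY] := PY.
  by apply: le_trans (FY st); apply: Fm => //; exact: MP.
have MF : le_fun M (F M).
  by apply: MP; split; [exact: FE|apply: Fm => //; exact: FE].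
have Mfix : is_lfp F M.
  split=> //; first by apply/funext => st; apply/eqP; rewrite eq_le FM MF.
  by move=> Z ZE FZ; apply: MP; split=> //; rewrite FZ => st.
have Lfix : is_lfp F (lfp F) by apply: xgetPex; exists M.
split=> // Z ZE FZ st; apply: le_trans (MP Z _ st); last by split.
case: Lfix Mfix => LE FL Lmin [_ FMM _]; exact: Lmin.
Qed.

Lemma gfpP F : monotone01 F -> is_gfp F (gfp F) /\
  forall Z, one_bounded Z -> le_fun Z (F Z) -> le_fun Z (gfp F).
Proof.
move=> [FE Fm].
pose P := [set Y | one_bounded Y /\ le_fun Y (F Y)].
pose M st := sup01 [set Y st | Y in P].
have P01 st r : [set Y st | Y in P] r -> 0 <= r <= 1.
  by move=> [Y [YE _] <-]; exact: YE.
have ME : one_bounded M by move=> st; apply: sup01_itv; exact: P01.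
have MP Y : P Y -> le_fun Y M.
  by move=> PY st; apply: sup01_ub; [exact: P01|exists Y].
have FM : le_fun M (F M).
  move=> st; apply: sup01_le; first by case/andP: (FE _ ME st).
  move=> _ [Y PY <-]; have [YE FY] := PY.
  by apply: (le_trans (FY st)); apply: Fm => //; exact: MP.
have MF : le_fun (F M) M.
  by apply: MP; split; [exact: FE|apply: Fm => //; exact: FE].
have Mfix : is_gfp F M.
  split=> //; first by apply/funext => st; apply/eqP; rewrite eq_le FM MF.
  by move=> Z ZE FZ; apply: MP; split=> //; rewrite FZ => st.
have Lfix : is_gfp F (gfp F) by apply: xgetPex; exists M.
split=> // Z ZE FZ st; apply: (le_trans (MP Z _ st)); first by split.
case: Lfix Mfix => LE FL Lmin [_ FMM _]; exact: Lmin.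
Qed.

Lemma indic01 (A : set state) : one_bounded \1_A.
Proof. by move=> st; rewrite indicE; case: (_ \in _); rewrite lexx ler01. Qed.

Lemma conv01 (p a b : R) : 0 <= p <= 1 -> 0 <= a <= 1 -> 0 <= b <= 1 ->
  0 <= p * a + (1 - p) * b <= 1.
Proof. by move=> /andP[? ?] /andP[? ?] /andP[? ?]; apply/andP; split; nra. Qed.

Lemma conv_le (p a b a' b' : R) : 0 <= p <= 1 -> a <= a' -> b <= b' ->
  p * a + (1 - p) * b <= p * a' + (1 - p) * b'.
Proof. by move=> /andP[? ?] ? ?; nra. Qed.

Lemma indicC (A : set state) st : \1_(~` A) st = 1 - \1_A st :> R.
Proof. by rewrite !indicE in_setC; case: (_ \in _); rewrite ?subrr ?subr0. Qed.

Lemma sepcon_mono X : one_bounded X -> monotone01 (sepcon X).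
Proof.
move=> XE.
have S01 Y st : one_bounded Y -> forall r, (exists h1 h2,
    [/\ hdisj h1 h2, st.2 = hunion h1 h2
      & r = X (st.1, h1) * Y (st.1, h2)]) -> 0 <= r <= 1.
  move=> YE r [h1 [h2 [_ _ ->]]].
  have /andP[? ?] := XE (st.1, h1); have /andP[? ?] := YE (st.1, h2).
  by apply/andP; split; nra.
split=> [Y YE st|Y Z YE ZE YZ st]; first by apply: sup01_itv; exact: S01.
apply: sup01_mono; first exact: S01.
move=> r [h1 [h2 [d e ->]]]; exists (X (st.1, h1) * Z (st.1, h2)).
  by exists h1, h2.
by rewrite ler_wpM2l//; case/andP: (XE (st.1, h1)).
Qed.

Lemma sepdis_mono X : one_bounded X -> monotone01 (sepdis X).
Proof.
move=> XE.
have S01 Y st : one_bounded Y -> forall r, (exists h1 h2,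
    [/\ hdisj h1 h2, st.2 = hunion h1 h2
      & r = 1 - X (st.1, h1) + X (st.1, h1) * Y (st.1, h2)]) -> 0 <= r <= 1.
  move=> YE r [h1 [h2 [_ _ ->]]].
  have /andP[? ?] := XE (st.1, h1); have /andP[? ?] := YE (st.1, h2).
  by apply/andP; split; nra.
split=> [Y YE st|Y Z YE ZE YZ st]; first by apply: inf01_itv; exact: S01.
apply: inf01_mono; first exact: S01.
move=> r [h1 [h2 [d e ->]]].
exists (1 - X (st.1, h1) + X (st.1, h1) * Y (st.1, h2)); first by exists h1, h2.
by rewrite lerD2l ler_wpM2l//; case/andP: (XE (st.1, h1)).
Qed.

Lemma sepimp_mono phi : monotone01 (sepimp phi).
Proof.
have S01 Y st : one_bounded Y -> forall r, (exists h',
    [/\ hdisj h' st.2, phi (st.1, h') & r = Y (st.1, hunion st.2 h')]) ->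
    0 <= r <= 1.
  by move=> YE r [h' [_ _ ->]].
split=> [Y YE st|Y Z YE ZE YZ st]; first by apply: inf01_itv; exact: S01.
apply: inf01_mono; first exact: S01.
move=> r [h' [d e ->]].
by exists (Y (st.1, hunion st.2 h')); [exists h'|exact: YZ].
Qed.

Lemma sepcoimp_mono phi : monotone01 (sepcoimp phi).
Proof.
have S01 Y st : one_bounded Y -> forall r, (exists h',
    [/\ hdisj h' st.2, phi (st.1, h') & r = Y (st.1, hunion st.2 h')]) ->
    0 <= r <= 1.
  by move=> YE r [h' [_ _ ->]].
split=> [Y YE st|Y Z YE ZE YZ st]; first by apply: sup01_itv; exact: S01.
apply: sup01_mono; first exact: S01.
move=> r [h' [d e ->]].
by exists (Z (st.1, hunion st.2 h')); [exists h'|exact: YZ].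
Qed.

Lemma con_mono ext X : one_bounded X -> monotone01 (con ext X).
Proof. by case: ext; [exact: sepdis_mono|exact: sepcon_mono]. Qed.

Lemma imp_mono ext phi : monotone01 (imp ext phi).
Proof. by case: ext; [exact: sepcoimp_mono|exact: sepimp_mono]. Qed.

Lemma comp_mono F G : monotone01 F -> monotone01 G -> monotone01 (F \o G).
Proof.
move=> [FE Fm] [GE Gm]; split=> [X XE|X Y XE YE XY]; first exact/FE/GE.
by apply: Fm; [exact: GE|exact: GE|exact: Gm].
Qed.

Lemma subst_mono x e : monotone01 (fun X => subst X x e).
Proof. by split=> [X XE st|X Y _ _ XY st]; [exact: XE|exact: XY]. Qed.

Lemma bigsup_mono (D : state -> set int) (F : int -> (state -> R) -> state -> R)
    (q : bool) : (forall v, monotone01 (F v)) ->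
  monotone01 (fun X st =>
    (if q then sup01 else inf01) [set F v X st | v in D st]).
Proof.
move=> Fm.
have S01 X st : one_bounded X ->
    forall r, [set F v X st | v in D st] r -> 0 <= r <= 1.
  by move=> XE _ [v _ <-]; exact: (Fm v).1.
split=> [X XE st|X Y XE YE XY st]; case: q.
- by apply: sup01_itv; exact: S01.
- by apply: inf01_itv; exact: S01.
- apply: sup01_mono; first exact: S01.
  by move=> _ [v Dv <-]; exists (F v Y st); [exists v|exact: (Fm v).2].
- apply: inf01_mono; first exact: S01.
  by move=> _ [v Dv <-]; exists (F v X st); [exists v|exact: (Fm v).2].
Qed.

Lemma while_fun_mono b X G :
  one_bounded X -> monotone01 G -> monotone01 (while_fun b X G).
Proof.
move=> XE [GE Gm]; split=> [Y YE st|Y Z YE ZE YZ st];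
  rewrite /while_fun indicC addrC.
- by apply: conv01; [exact: indic01|exact: GE|exact: XE].
- rewrite [leRHS]addrC; apply: conv_le => //; [exact: indic01|exact: Gm].
Qed.

Lemma trans_mono angelic liberal extrinsic c :
  monotone01 (trans angelic liberal extrinsic c).
Proof.
elim: c => [|x e|c1 IH1 c2 IH2|b c1 IH1 c2 IH2|b c IH|c1 IH1 p c2 IH2
           |x es|e e'|x e|e] /=.
- by split.
- exact: subst_mono.
- exact: (comp_mono IH1 IH2).
- split=> [X XE st|X Y XE YE XY st]; rewrite indicC.
    by apply: conv01; [exact: indic01|exact: IH1.1|exact: IH2.1].
  by apply: conv_le; [exact: indic01|exact: IH1.2|exact: IH2.2].
- set G := trans _ _ _ c in IH *.
  have W X XE := while_fun_mono b (X := X) XE IH.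
  have WX X Y Z : le_fun X Y ->
      le_fun (while_fun b X G Z) (while_fun b Y G Z).
    move=> XY st; have /andP[i0 _] := indic01 (~` guard b) st.
    by rewrite lerD2r ler_wpM2l.
  split=> [X XE|X Y XE YE XY]; case: liberal @G IH W WX => G IH W WX.
  + by have [[]] := gfpP (W X XE).
  + by have [[]] := lfpP (W X XE).
  + have [[XE' X1 _] _] := gfpP (W X XE); have [_ Ymax] := gfpP (W Y YE).
    by apply: Ymax => // st; rewrite -[leLHS](congr1 (@^~ st) X1); exact: WX.
  + have [_ Xmin] := lfpP (W X XE); have [[YE' Y1 _] _] := lfpP (W Y YE).
    by apply: Xmin => // st; rewrite -[leRHS](congr1 (@^~ st) Y1); exact: WX.
- have p01 : 0 <= (ratr (val p) : R) <= 1.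
    case: p => /= q /andP[q0]; rewrite ler0q q0 -(ler_rat R).
    by rewrite rmorph1.
  split=> [X XE st|X Y XE YE XY st].
    by apply: conv01 => //; [exact: IH1.1|exact: IH2.1].
  by apply: conv_le => //; [exact: IH1.2|exact: IH2.2].
- apply: (@bigsup_mono (fun st => [set v : int | _])
    (fun v X => imp _ (pointsto (cst v) es) (subst X x (cst v)))) => v.
  exact: (comp_mono (imp_mono _ _) (subst_mono _ _)).
- apply: (@comp_mono (con _ _)); last exact: imp_mono.
  by apply: con_mono; exact: indic01.
- have := @bigsup_mono (fun=> [set: int]) (fun v X =>
    con extrinsic \1_(pointsto e [:: cst v])
      (imp extrinsic (pointsto e [:: cst v]) (subst X x (cst v))))
    (~~ extrinsic).
  rewrite if_neg; apply => v.
  apply: (@comp_mono (con _ _)); first by apply: con_mono; exact: indic01.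
  exact: (comp_mono (imp_mono _ _) (subst_mono _ _)).
- by apply: con_mono; exact: indic01.
Qed.

Lemma while_fpP angelic liberal extrinsic b c X : one_bounded X ->
  (if liberal then is_gfp else is_lfp)
    (while_fun b X (trans angelic liberal extrinsic c))
    (trans angelic liberal extrinsic (While b c) X).
Proof.
move=> XE.
have W := while_fun_mono b XE (trans_mono angelic liberal extrinsic c).
by case: liberal W => /= W; [case: (gfpP W)|case: (lfpP W)].
Qed.

End Transformers.

(* Main.v *)
(** Complementing a [0, 1]-valued function exchanges suprema with infima, least
    with greatest fixed points, [sepcon] with [sepdis] and [sepimp] with
    [sepcoimp].  By induction on the program, conjugating a transformer by the
    complement therefore flips its three flags simultaneously, and the four
    identities are the instances of this single duality. *)

Require Import Defs.
From HB Require Import structures.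
From mathcomp Require Import all_boot all_order all_algebra.
From mathcomp Require Import all_classical all_reals.
From mathcomp Require Import ring lra.

Set Implicit Arguments.
Unset Strict Implicit.
Unset Printing Implicit Defensive.

Import Order.TTheory GRing.Theory Num.Theory.

Local Open Scope classical_set_scope.
Local Open Scope ring_scope.

Section UnitInterval.
Variable R : realType.

Lemma compl_itv01 (r : R) : 0 <= r <= 1 -> 0 <= 1 - r <= 1.
Proof. by move=> /andP[? ?]; apply/andP; split; lra. Qed.

(** The map r ↦ 1 - r reverses the order, so each inequality follows by moving bounds across it. The
    adjoined elements 0 and 1 are also exchanged, which covers empty [D]. *)
Lemma sup01_compl (I : Type) (D : set I) (f : I -> R) :
    (forall i, D i -> 0 <= f i <= 1) ->
  sup01 [set 1 - f i | i in D] = 1 - inf01 [set f i | i in D].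
Proof.
move=> f01.
have f01' r : [set f i | i in D] r -> 0 <= r <= 1 by move=> [i /f01 ? <-].
have /andP[_ f1] := inf01_itv f01'.
have g01 r : [set 1 - f i | i in D] r -> 0 <= r <= 1.
  by move=> [i /f01 fi <-]; exact: compl_itv01.
have /andP[_ g1] := sup01_itv g01.
apply/eqP; rewrite eq_le; apply/andP; split.
  apply: sup01_le; first by rewrite subr_ge0.
  by move=> _ [i Di <-]; rewrite lerD2l lerN2; apply: inf01_lb => //; exists i.
have /andP[g0 _] := sup01_itv g01.
rewrite lerBlDr -lerBlDl; apply: inf01_ge; first by rewrite lerBlDr lerDl.
move=> _ [i Di <-]; rewrite lerBlDl -lerBlDr.
by apply: sup01_ub => //; exists i.
Qed.

Lemma inf01_compl (I : Type) (D : set I) (f : I -> R) :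
    (forall i, D i -> 0 <= f i <= 1) ->
  inf01 [set 1 - f i | i in D] = 1 - sup01 [set f i | i in D].
Proof.
move=> f01.
have /sup01_compl : forall i, D i -> 0 <= 1 - f i <= 1.
  by move=> i /f01; exact: compl_itv01.
under eq_imagel do rewrite subKr.
by move=> ->; rewrite subKr.
Qed.

(** Keeping the flag symbolic lets one rewrite serve both values of [ang] and of [ext] in the cases
    below. *)
Lemma extr01_compl (q : bool) (I : Type) (D : set I) (f : I -> R) :
    (forall i, D i -> 0 <= f i <= 1) ->
  (if ~~ q then @sup01 R else @inf01 R) [set 1 - f i | i in D] =
  1 - (if q then @sup01 R else @inf01 R) [set f i | i in D].
Proof. by case: q => f01; [exact: inf01_compl|exact: sup01_compl]. Qed.

End UnitInterval.

Section Duality.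
Variables (R : realType) (Var : eqType).

Local Notation expectation := (state Var -> R).
Implicit Types (X Y Z : expectation) (F G : expectation -> expectation).

Definition compl X : expectation := fun st => 1 - X st.

Lemma complK : involutive compl.
Proof. by move=> X; apply/funext => st; rewrite /compl subKr. Qed.

Lemma compl_one_bounded X : one_bounded X -> one_bounded (compl X).
Proof. by move=> X01 st; exact: compl_itv01. Qed.

(** The index set of splittings is the same for both flags, so the two connectives become extrema of
    indexed families to which [extr01_compl] applies. *)
Lemma con_extr (ext : bool) X Y st :
  con ext X Y st =
  (if ~~ ext then @sup01 R else @inf01 R)
    [set (if ext then 1 - X (st.1, h.1) + X (st.1, h.1) * Y (st.1, h.2)
          else X (st.1, h.1) * Y (st.1, h.2))
    | h in [set h | hdisj h.1 h.2 /\ st.2 = hunion h.1 h.2]].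
Proof.
case: ext; [congr (inf01 _)|congr (sup01 _)]; apply/seteqP; split=> r /=.
- by move=> [h1 [h2 [d e ->]]]; exists (h1, h2).
- by move=> [[h1 h2] /= [d e] <-]; exists h1, h2.
- by move=> [h1 [h2 [d e ->]]]; exists (h1, h2).
- by move=> [[h1 h2] /= [d e] <-]; exists h1, h2.
Qed.

(** Only the second argument is complemented: 1 - a + a(1 - b) = 1 - ab, and conversely a(1 - b) = 1
    - (1 - a + ab). *)
Lemma con_compl ext X Y : one_bounded X -> one_bounded Y ->
  con (~~ ext) X (compl Y) = compl (con ext X Y).
Proof.
move=> X01 Y01; apply/funext => st.
rewrite /compl !con_extr -extr01_compl => [|[h1 h2] _ /=]; last first.
  have /andP[? ?] := X01 (st.1, h1); have /andP[? ?] := Y01 (st.1, h2).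
  by case: ext; apply/andP; split; nra.
by congr (_ _); apply: eq_imagel => h _; case: ext => /=; ring.
Qed.

Lemma imp_extr (ext : bool) phi Y st :
  imp ext phi Y st =
  (if ext then @sup01 R else @inf01 R)
    [set Y (st.1, hunion st.2 h)
    | h in [set h | hdisj h st.2 /\ phi (st.1, h)]].
Proof.
case: ext; [congr (sup01 _)|congr (inf01 _)]; apply/seteqP; split=> r /=.
- by move=> [h [d p ->]]; exists h.
- by move=> [h [d p] <-]; exists h.
- by move=> [h [d p ->]]; exists h.
- by move=> [h [d p] <-]; exists h.
Qed.

Lemma imp_compl ext phi Y : one_bounded Y ->
  imp (~~ ext) phi (compl Y) = compl (imp ext phi Y).
Proof.
move=> Y01; apply/funext => st.
by rewrite /compl !imp_extr -extr01_compl.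
Qed.

Lemma is_gfp_unique F Y Z : is_gfp F Y -> is_gfp F Z -> Y = Z.
Proof.
move=> [Y01 FY Ymax] [Z01 FZ Zmax]; apply/funext => st.
by apply/eqP; rewrite eq_le Ymax// Zmax.
Qed.

(** [compl] is an order-reversing involution conjugating [F] to [G], so it matches their fixed
    points and turns the least into the greatest. *)
Lemma is_lfp_compl F G Y :
    (forall Z, one_bounded Z -> G (compl Z) = compl (F Z)) ->
  is_lfp F Y -> is_gfp G (compl Y).
Proof.
move=> GF [Y01 FY Ymin]; split; first exact: compl_one_bounded.
  by rewrite GF// FY.
move=> Z Z01 GZ st; have cZ01 := compl_one_bounded Z01.
rewrite lerBrDl -lerBrDr; apply: (Ymin (compl Z)) => //.
(* [compl Z] is fixed by [F]: complementing both sides turns this into [G Z = Z]. *)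
by apply: (can_inj complK); rewrite -GF// complK.
Qed.

(** Monotonicity guarantees that the chosen [lfp F] and [gfp G] are genuine extremal fixed points;
    uniqueness then identifies them. *)
Lemma gfp_compl F G : monotone01 F -> monotone01 G ->
    (forall Z, one_bounded Z -> G (compl Z) = compl (F Z)) ->
  gfp G = compl (lfp F).
Proof.
move=> /lfpP[Flfp _] /gfpP[Ggfp _] GF.
exact: is_gfp_unique Ggfp (is_lfp_compl GF Flfp).
Qed.

(** The conjugation relation is symmetric because [compl] is an involution, so [F] and [G] may be
    exchanged in [gfp_compl]. *)
Lemma lfp_compl F G : monotone01 F -> monotone01 G ->
    (forall Z, one_bounded Z -> G (compl Z) = compl (F Z)) ->
  lfp G = compl (gfp F).
Proof.
move=> Fm Gm GF; rewrite (gfp_compl Gm Fm) ?complK// => Z Z01.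
apply: (can_inj complK); rewrite -GF ?complK//.
exact: compl_one_bounded.
Qed.

(** The two indicator weights sum to 1, so the combination commutes with complement. *)
Lemma while_fun_compl b X F G :
    (forall Z, one_bounded Z -> G (compl Z) = compl (F Z)) ->
  forall Z, one_bounded Z ->
    while_fun b (compl X) G (compl Z) = compl (while_fun b X F Z).
Proof.
move=> GF Z Z01; apply/funext => st.
by rewrite /while_fun GF// /compl indicC; ring.
Qed.

Lemma trans_compl ang lib ext (c : cmd Var) X : one_bounded X ->
  trans (~~ ang) (~~ lib) (~~ ext) c (compl X) =
  compl (trans ang lib ext c X).
Proof.
have imp01 e phi Y : one_bounded Y -> one_bounded (imp e phi Y).
  by move=> Y01; exact: (imp_mono R e phi).1.
elim: c X => [|x e|c1 IH1 c2 IH2|b c1 IH1 c2 IH2|b c IH|c1 IH1 p c2 IH2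
             |x es|e e'|x e|e] //= X X01.
- by rewrite IH2// IH1//; exact: (trans_mono R _ _ _ _).1.
- by apply/funext => st; rewrite IH1// IH2// /compl indicC; ring.
- have Fm := while_fun_mono b X01 (trans_mono R ang lib ext c).
  have Gm := while_fun_mono b (compl_one_bounded X01)
    (trans_mono R (~~ ang) (~~ lib) (~~ ext) c).
  have GF := while_fun_compl b X IH.
  by case: lib {IH} Fm Gm GF => Fm Gm GF; [exact: lfp_compl|exact: gfp_compl].
- by apply/funext => st; rewrite IH1// IH2// /compl; ring.
- apply/funext => st; rewrite /compl -extr01_compl => [|v _]; last first.
    by apply: imp01 => st'; exact: X01.
  congr (_ _); apply: eq_imagel => v _.
  (* Substitution commutes with [compl] by conversion, so only the implication has to be
     dualised. *)
  by rewrite -[RHS]/(compl _ st) -imp_compl// => st'; exact: X01.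
- by rewrite imp_compl// con_compl//; [exact: indic01|exact: imp01].
- have sX01 v : one_bounded (subst X x (cst v)) by move=> st'; exact: X01.
  (* The lookup rule takes the infimum when its flag is true, the opposite of the convention in
     [extr01_compl]. *)
  have swap (b : bool) : (if b then @inf01 R else @sup01 R) =
    (if ~~ b then @sup01 R else @inf01 R) by case: b.
  apply/funext => st; rewrite !swap /compl -extr01_compl => [|v _].
    congr (_ _); apply: eq_imagel => v _.
    rewrite -[RHS]/(compl _ st) -con_compl ?imp_compl//; last exact: imp01.
    exact: indic01.
  by apply: (con_mono ext (indic01 R _)).1; exact: imp01.
- by rewrite con_compl//; exact: indic01.
Qed.

End Duality.

Theorem theorem5p3 (R : realType) (Var : eqType) (c : cmd Var)
    (X : state Var -> R) (hX : one_bounded X) :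
  [/\ wp c X = (fun st => 1 - awlep c (fun st' => 1 - X st') st),
      wlp c X = (fun st => 1 - awep c (fun st' => 1 - X st') st),
      wep c X = (fun st => 1 - awlp c (fun st' => 1 - X st') st)
    & wlep c X = (fun st => 1 - awp c (fun st' => 1 - X st') st)].
Proof.
have dual ang lib ext : trans ang lib ext c X =
    compl (trans (~~ ang) (~~ lib) (~~ ext) c (compl X)).
  by rewrite trans_compl// complK.
by split; exact: dual.
Qed.
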